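(* Let $(d,n)\in\{(3,6),(4,8),(4,12)\}$, let $\mathcal{C}(d,n,z)$, $|z|=1$, be the set of coherent states $|a_z(\hat r,\mu)\rangle\in H(d)$ defined in the context, and fix an orbit index $\mu\in\{0,\dots,\frac nd-1\}$. For $\hat r=0,\dots,d-1$ let $h(\hat r)\subset H(d)$ be the one-dimensional subspace spanned by $|a_z(\hat r,\mu)\rangle$. Then for all $z$ on the unit circle except finitely many: (i) $h(0)\vee h(1)\vee\cdots\vee h(d-1)=H(d)$, equivalently $h(0)^\perp\wedge h(1)^\perp\wedge\cdots\wedge h(d-1)^\perp=\{0\}$; (ii) the logical Bell-like inequalities $$\sum_{\hat r=0}^{d-1}p[h(\hat r)^\perp|\rho]\le d-1,\qquad 1\le\sum_{\hat r=0}^{d-1}p[h(\hat r)|\rho]$$ are violated: there exist density matrices $\rho$ on $H(d)$ for which $$\sum_{\hat r=0}^{d-1}p[h(\hat r)^\perp|\rho]>d-1\qquad\text{and}\qquad\sum_{\hat r=0}^{d-1}p[h(\hat r)|\rho]<1 .$$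
   Context: $H(d)=\mathbb{C}^d$ with standard inner product. For subspaces $h_1,h_2$ of $H(d)$: $h_1\wedge h_2=h_1\cap h_2$, $h_1\vee h_2=\operatorname{span}(h_1\cup h_2)$, and $h^\perp$ is the orthogonal complement of $h$. A density matrix $\rho$ is a positive semidefinite Hermitian $d\times d$ matrix with trace $1$. For a subspace $h$ with orthogonal projector $\Pi(h)$, the quantum probability is $p(h|\rho)=\operatorname{Tr}[\rho\,\Pi(h)]$. $X$ is the $d\times d$ cyclic permutation matrix $X(v_0,v_1,\dots,v_{d-1})^T=(v_1,\dots,v_{d-1},v_0)^T$. Coherent states. For $|z|=1$, $|a_z(\hat r,\mu)\rangle=X^{\hat r}|a_z(0,\mu)\rangle$ for $\hat r\in\{0,\dots,d-1\}$, $\mu\in\{0,\dots,\frac nd-1\}$ ($\mu$ labels the orbit under the cyclic group generated by $X$), with starting vectors: - $\mathcal{C}(3,6,z)$: $|a_z(0,0)\rangle=\frac1{\sqrt2}(1,z,0)^T$, $|a_z(0,1)\rangle=\frac1{\sqrt2}(1,-z,0)^T$. - $\mathcal{C}(4,8,z)$: $|a_z(0,0)\rangle=\frac1{\sqrt2}(z,1,0,0)^T$, $|a_z(0,1)\rangle=\frac1{\sqrt2}(z,-1,0,0)^T$. - $\mathcal{C}(4,12,z)$: with $\omega=e^{2\pi i/3}$, $|a_z(0,0)\rangle=\frac1{\sqrt3}(z,1,1,0)^T$, $|a_z(0,1)\rangle=\frac1{\sqrt3}(z,\omega,\omega^2,0)^T$, $|a_z(0,2)\rangle=\frac1{\sqrt3}(z,\omega^2,\omega,0)^T$.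 *)

(* Defs.v *)
From HB Require Import structures.
From mathcomp Require Import all_boot all_order all_algebra.
From mathcomp Require Import sesquilinear spectral.
From mathcomp Require Import complex.
From mathcomp Require Import reals trigo.

Set Implicit Arguments.
Unset Strict Implicit.
Unset Printing Implicit Defensive.

Import Order.TTheory GRing.Theory Num.Theory.
Local Open Scope ring_scope.
Local Open Scope sesquilinear_scope.

Section QuantumProbability.
Variables (C : numClosedFieldType) (d : nat).
Implicit Types (u v : 'cV[C]_d) (h : {vspace 'cV[C]_d}) (rho : 'M[C]_d).

(* Linear in u, antilinear in v; see cinnerE. *)
Definition cinner u v : C := form_of_matrix Num.conj (1%:M : 'M[C]_1) u v.

HB.instance Definition _ := Bilinear.copy cinner
  (form_of_matrix Num.conj (mx_of_hermitian (hermitian1mx 1)) :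
     'cV[C]_d -> 'cV[C]_d -> C).
HB.instance Definition _ := Hermitian.copy cinner
  (form_of_matrix Num.conj (mx_of_hermitian (hermitian1mx 1)) :
     'cV[C]_d -> 'cV[C]_d -> C).

Lemma cinnerE u v : cinner u v = (v ^t* *m u) 0 0.
Proof. by rewrite /cinner /form_of_matrix mulmx1 mxtrace_mulC trace_mx11. Qed.

Definition orthocompl h : {vspace 'cV[C]_d} := orthov cinner h.

(* The matrix, acting on column vectors, of the projection onto h along its
   orthogonal complement. *)
Definition orthoproj h : 'M[C]_d :=
  \matrix_(i, j) daddv_pi h (orthocompl h) (delta_mx j 0 : 'cV[C]_d) i 0.

Definition density_matrix rho : Prop :=
  [/\ rho \is hermsymmx,
      forall v, 0 <= (v ^t* *m rho *m v) 0 0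
    & \tr rho = 1].

(* Valued in C: on C, x < y means that y - x is real and positive, so strict
   inequalities between such traces are the usual ones between reals. *)
Definition qprob h rho : C := \tr (rho *m orthoproj h).

(* (X v)_i = v_(i + 1 mod d). *)
Definition cyclicX : 'M[C]_d := \matrix_(i, j) (j == ordS i)%:R.

Definition colseq (s : seq C) : 'cV[C]_d := \col_(i < d) s`_i.

End QuantumProbability.

Section CoherentStates.
Variable R : realType.
Local Notation C := R[i].

Definition omega : C := Complex (cos (2 * pi / 3)) (sin (2 * pi / 3)).

(* Only the three families (3, 6), (4, 8), (4, 12) with mu < n / d are
   meaningful; the other values are junk. *)
Definition coherent_start (d n mu : nat) (z : C) : 'cV[C]_d :=
  match d, n, mu with
  | 3, 6, 0 => ((sqrtC 2)^-1 *: colseq d [:: 1; z; 0])%R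
  | 3, 6, 1 => ((sqrtC 2)^-1 *: colseq d [:: 1; - z; 0])%R
  | 4, 8, 0 => ((sqrtC 2)^-1 *: colseq d [:: z; 1; 0; 0])%R
  | 4, 8, 1 => ((sqrtC 2)^-1 *: colseq d [:: z; - 1; 0; 0])%R
  | 4, 12, 0 => ((sqrtC 3)^-1 *: colseq d [:: z; 1; 1; 0])%R
  | 4, 12, 1 => ((sqrtC 3)^-1 *: colseq d [:: z; omega; omega ^+ 2; 0])%R
  | 4, 12, 2 => ((sqrtC 3)^-1 *: colseq d [:: z; omega ^+ 2; omega; 0])%R
  | _, _, _ => 0%R
  end%N.

Definition coherent (d n : nat) (z : C) (r mu : nat) : 'cV[C]_d :=
  cyclicX C d ^+ r *m coherent_start d n mu z.

Definition coherent_space (d n : nat) (z : C) (mu r : nat) :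
  {vspace 'cV[C]_d} := <[coherent d n z r mu]>%VS.

End CoherentStates.

(* Main.v *)
(** Write a(z) = c (z e_k + b).  The matrix with columns X^r a(z) is c (z P + B)
    with P a permutation matrix, so it is invertible unless z is an eigenvalue of
    - P^-1 B; this gives (i).  For (ii), let T be the sum over r of the projectors
    on h(r).  Since the orbit is cyclic, every diagonal entry of T is 1, and the
    off-diagonal entry t = T_{0,1} is, up to a constant, affine and nonconstant in
    z or conj z, hence nonzero for all but finitely many z.  The unnormalised
    state v = e_0 - conj(t) e_1 then has <v, T v> = 1 - |t|^2 < 1 + |t|^2 = <v, v>,
    and the second inequality of (ii) is the complement of the first. *)
Require Import Defs.
From mathcomp Require Import all_boot all_order all_algebra.
From mathcomp Require Import sesquilinear spectral.
From mathcomp Require Import complex reals trigo.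
From mathcomp Require Import ring.
Set Implicit Arguments.
Unset Strict Implicit.
Unset Printing Implicit Defensive.

Import Order.TTheory GRing.Theory Num.Theory.
Local Open Scope ring_scope.
Local Open Scope sesquilinear_scope.

Lemma daddv_piD (K : fieldType) (vT : vectType K) (U V : {vspace vT}) u v :
  (U :&: V = 0)%VS -> u \in U -> v \in V -> daddv_pi U V (u + v) = u.
Proof.
move=> UV0 Uu Vv; have VU0 : (V :&: U = 0)%VS by rewrite capvC.
have := daddv_pi_add UV0 (memv_add (mem0v U) Vv).
rewrite add0r (daddv_pi_id VU0 Vv) => /(canRL (addrK _)); rewrite subrr => pv0.
by rewrite linearD /= pv0 addr0 daddv_pi_id.
Qed.

(** * Orthogonal projections onto lines, rank-one states and their probabilities *)

Section LineProjections.
Variables (C : numClosedFieldType) (d : nat).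
Implicit Types (a u v w : 'cV[C]_d) (V : {vspace 'cV[C]_d}).

Lemma cinner_sum u v : cinner u v = \sum_i u i 0 * (v i 0)^*.
Proof. by rewrite cinnerE mxE; apply: eq_bigr => i _; rewrite !mxE mulrC. Qed.

Lemma cinner_self_eq0 u : (cinner u u == 0) = (u == 0).
Proof.
apply/eqP/eqP => [|->]; last by rewrite linear0l.
rewrite cinner_sum => /eqP; rewrite psumr_eq0 => [/allP u0|i _]; last first.
  exact: mul_conjC_ge0.
apply/colP => i; have := u0 i (mem_index_enum i).
by rewrite mul_conjC_eq0 mxE => /eqP.
Qed.

Lemma capv_orthocompl V : (V :&: orthocompl V = 0)%VS.
Proof.
apply/eqP; rewrite -subv0; apply/subvP => u; rewrite memv_cap memv0.
case/andP=> Vu /mem_orthovP/(_ u Vu)/eqP.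
by rewrite cinner_self_eq0.
Qed.

Lemma line_decomp a w : cinner a a = 1 ->
  exists2 v, v \in orthocompl <[a]> & w = cinner w a *: a + v.
Proof.
move=> a1; exists (w - cinner w a *: a); last by rewrite addrC subrK.
by rewrite mem_orthov1 linearBl /= linearZl_LR /= a1 mulr1 subrr.
Qed.

(** Column j is the projection of the basis vector e_j, namely <e_j, a> a, and <e_j, a> is the
    conjugate of the j-th entry of [a]. *)
Lemma orthoproj_line a : cinner a a = 1 -> orthoproj <[a]> = a *m a ^t*.
Proof.
move=> a1; apply/matrixP => i j; rewrite !mxE big_ord1.
have [v av {1}->] := line_decomp (delta_mx j 0) a1.
rewrite daddv_piD ?capv_orthocompl ?memvZ ?memv_line //.
rewrite cinnerE !mxE (bigD1 j) //= big1 ?addr0 => [|k nkj].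
  by rewrite !mxE !eqxx mulr1 mulrC.
by rewrite !mxE (negPf nkj) mulr0.
Qed.

(** Projecting onto [orthocompl <[a]>] takes place along its own complement, which therefore has to
    be identified. If w = <w, a> a + v is orthogonal to v, then <v, v> = 0. *)
Lemma orthocompl_lineK a :
  cinner a a = 1 -> orthocompl (orthocompl <[a]>) = <[a]>%VS.
Proof.
move=> a1; apply/eqP; rewrite eqEsubv; apply/andP; split; last first.
  by rewrite /orthocompl orthov_sym.
apply/subvP => w; have [v av {1 2}->] := line_decomp w a1.
move=> /mem_orthovP/(_ v av).
have va : cinner a v = 0.
  by apply/eqP; move: av; rewrite mem_orthov1_sym mem_orthov1.
rewrite linearDl /= linearZl_LR /= va mulr0 add0r => /eqP.
by rewrite cinner_self_eq0 => /eqP->; rewrite addr0 memvZ ?memv_line.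
Qed.

Lemma orthoproj_orthocompl_line a :
  cinner a a = 1 -> orthoproj (orthocompl <[a]>) = 1%:M - a *m a ^t*.
Proof.
move=> a1; rewrite -orthoproj_line //; apply/matrixP => i j.
rewrite !mxE orthocompl_lineK //.
have VU0 := capv_orthocompl <[a]>.
have UV0 : (orthocompl <[a]> :&: <[a]> = 0)%VS by rewrite capvC.
have [v av def_e] := line_decomp (delta_mx j 0) a1.
have La : cinner (delta_mx j 0) a *: a \in <[a]>%VS by rewrite memvZ ?memv_line.
have e_i : (delta_mx j 0 : 'cV[C]_d) i 0 = (cinner (delta_mx j 0) a *: a + v) i 0.
  by rewrite -def_e.
rewrite {1 2}def_e (daddv_piD VU0 La av) [_ *: a + v]addrC.
rewrite (daddv_piD UV0 av La).
move: e_i; rewrite !mxE eqxx andbT => ->.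
by rewrite addrAC subrr add0r.
Qed.

Lemma qprob_line (rho : 'M[C]_d) a : cinner a a = 1 ->
  qprob <[a]> rho = \tr (rho *m (a *m a ^t*)).
Proof. by move=> a1; rewrite /qprob orthoproj_line. Qed.

Lemma qprob_orthocompl_line (rho : 'M[C]_d) a : cinner a a = 1 ->
  qprob (orthocompl <[a]>) rho = \tr rho - qprob <[a]> rho.
Proof.
move=> a1; rewrite qprob_line // /qprob orthoproj_orthocompl_line //.
by rewrite mulmxBr mulmx1 linearB.
Qed.

(** A vector orthogonal to every [h r] is orthogonal to their sum, here the whole space, hence to
    itself. *)
Lemma bigcap_orthocompl m (h : 'I_m -> {vspace 'cV[C]_d}) :
  (\sum_(r < m) h r)%VS = fullv -> (\bigcap_(r < m) orthocompl (h r))%VS = 0%VS.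
Proof.
move=> h_full; apply/eqP; rewrite -subv0 -(capv_orthocompl fullv) capfv.
apply/subvP => u /subv_bigcapP-/(_ _ isT) hu.
apply/mem_orthovP => v _.
have /memv_sumP[vs vsh ->] : v \in (\sum_(r < m) h r)%VS by rewrite h_full memvf.
rewrite linear_sumr big1 // => r _.
by have /mem_orthovP/(_ (vs r)) := hu r; apply; apply: vsh.
Qed.

(** Writing A for the matrix with columns [a r], v = A (B v) expresses any v as a combination of the
    [a r]. *)
Lemma sum_lines_full m (a : 'I_m -> 'cV[C]_d) (B : 'M[C]_(m, d)) :
  (\matrix_(i, r) a r i 0) *m B = 1%:M -> (\sum_(r < m) <[a r]>)%VS = fullv.
Proof.
move=> AB1; apply/eqP; rewrite eqEsubv subvf; apply/subvP => v _.
rewrite -[v]mul1mx -AB1 -mulmxA.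
have -> (u : 'cV[C]_m) : (\matrix_(i, r) a r i 0) *m u = \sum_(r < m) u r 0 *: a r.
  apply/colP => i; rewrite !mxE summxE; apply: eq_bigr => r _.
  by rewrite !mxE mulrC.
by apply: memv_sumr => r _; rewrite memvZ ?memv_line.
Qed.

(** Dividing by the squared norm allows unnormalised [v] and avoids square roots. *)
Definition pure_state v : 'M[C]_d := (cinner v v)^-1 *: (v *m v ^t*).

Lemma cinnerC u v : cinner u v = (cinner v u)^*.
Proof. by rewrite (hermC (@cinner C d)) expr0 mul1r. Qed.

Lemma cinner_self_ge0 v : 0 <= cinner v v.
Proof. by rewrite cinner_sum sumr_ge0 // => i _; apply: mul_conjC_ge0. Qed.

Lemma pure_stateP v : v != 0 -> density_matrix (pure_state v).
Proof.
move=> v0; split.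
- apply/is_hermitianmxP; rewrite expr0 scale1r /pure_state.
  rewrite linearZ /= map_mxZ trmx_mul map_mxM /= trmxCK conj_Creal //.
  by rewrite rpredV ger0_real ?cinner_self_ge0.
- move=> u; rewrite /pure_state -scalemxAr -scalemxAl mxE mulr_ge0 //.
    by rewrite invr_ge0 cinner_self_ge0.
  rewrite -2!mulmxA mulmxA mxE big_ord1 -!cinnerE [cinner u v]cinnerC.
  exact: mul_conjC_ge0.
- rewrite mxtraceZ mxtrace_mulC trace_mx11 -cinnerE mulVf //.
  by rewrite cinner_self_eq0.
Qed.

Lemma qprob_line_pure_state a v : cinner a a = 1 ->
  qprob <[a]> (pure_state v) = cinner v a * (cinner v a)^* / cinner v v.
Proof.
move=> a1; rewrite qprob_line // /pure_state -scalemxAl mxtraceZ mulrC.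
congr (_ / _); rewrite mulmxA mxtrace_mulC -[_ *m a]mulmxA (mulmxA (a ^t* )) trace_mx11.
by rewrite mxE big_ord1 -!cinnerE -cinnerC.
Qed.

(** With T the sum of the projectors on the lines [a r], [t] is the entry T_ij and the last
    hypothesis says that T has unit diagonal. A nonzero off-diagonal entry then pushes <v, T v> /
    <v, v> below 1 for a suitable [v]. *)
Lemma pair_violation m (a : 'I_m -> 'cV[C]_d) (i j : 'I_d)
    (t := \sum_(r < m) a r i 0 * (a r j 0)^*) :
  i != j -> t != 0 -> (forall r, cinner (a r) (a r) = 1) ->
  (forall k, \sum_(r < m) a r k 0 * (a r k 0)^* = 1) ->
  exists rho : 'M[C]_d,
    [/\ density_matrix rho,
        \sum_(r < m) qprob (orthocompl <[a r]>) rho > m%:R - 1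
      & \sum_(r < m) qprob <[a r]> rho < 1].
Proof.
move=> nij t0 a1 rows1; have nji : j != i by rewrite eq_sym.
(* The coefficient [- t^*] makes each of the two cross terms of <v, T v> equal to -|t|^2. *)
pose v : 'cV[C]_d := delta_mx i 0 - t^* *: delta_mx j 0.
have va r : cinner v (a r) = (a r i 0)^* - t^* * (a r j 0)^*.
  rewrite cinner_sum (bigD1 i) //= (bigD1 j) //= big1 ?addr0 => [|k].
    by rewrite !mxE !eqxx (negPf nij) (negPf nji) /=; ring.
  by case/andP=> /negPf ki /negPf kj; rewrite !mxE ki kj /=; ring.
have vv : cinner v v = 1 + t * t^*.
  rewrite cinner_sum (bigD1 i) //= (bigD1 j) //= big1 ?addr0 => [|k].
    rewrite !mxE !eqxx (negPf nij) (negPf nji) /=.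
    by rewrite !(rmorphB, rmorphM, rmorph0, rmorph1, conjCK) /= ?conjCK; ring.
  by case/andP=> /negPf ki /negPf kj; rewrite !mxE ki kj /=; ring.
have tt_gt0 : 0 < t * t^* by rewrite mul_conjC_gt0.
have vv_gt0 : 0 < cinner v v by rewrite vv addr_gt0.
have v0 : v != 0 by rewrite -cinner_self_eq0 gt_eqF.
have sum_va : \sum_(r < m) cinner v (a r) * (cinner v (a r))^* = 1 - t * t^*.
  (* Expanded so that the four sums over r are T_ii, T_ij, the conjugate of T_ij, and T_jj. *)
  transitivity (\sum_(r < m) (a r i 0 * (a r i 0)^* - t^* * (a r i 0 * (a r j 0)^*)
     - t * (a r i 0 * (a r j 0)^*)^* + t * t^* * (a r j 0 * (a r j 0)^*))).
    apply: eq_bigr => r _; rewrite va.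
    by rewrite !(rmorphB, rmorphM, conjCK) /= ?conjCK; ring.
  rewrite big_split /= !sumrB -!mulr_sumr !rows1 -rmorph_sum /= -/t.
  by ring.
have [dm_rho1 dm_rho2 dm_tr] := pure_stateP v0.
have lt1 : \sum_(r < m) qprob <[a r]> (pure_state v) < 1.
  under eq_bigr do rewrite qprob_line_pure_state //.
  rewrite -mulr_suml sum_va ltr_pdivrMr // mul1r vv.
  by rewrite ltrD2l (lt_trans _ tt_gt0) // oppr_lt0.
exists (pure_state v); split => //.
under eq_bigr do rewrite qprob_orthocompl_line // dm_tr.
by rewrite sumrB sumr_const card_ord ltrD2l ltrN2.
Qed.

End LineProjections.

(** Factoring out -P leaves -P^-1 B - z, so [S] can be the list of roots of a characteristic
    polynomial, which splits over a closed field. *)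
Lemma affine_pencil_unitmx (C : closedFieldType) n (P B : 'M[C]_n) :
  P \in unitmx ->
  exists S : seq C, forall z, z \notin S -> z *: P + B \in unitmx.
Proof.
move=> P_unit; have [S def_p] := closed_field_poly_normal (char_poly (- (invmx P *m B))).
exists S => z; apply: contraR => zPB.
have -> : (z \in S) = root (char_poly (- (invmx P *m B))) z.
  rewrite def_p rootZ ?root_prod_XsubC //.
  by rewrite (monicP (char_poly_monic _)) oner_eq0.
rewrite -eigenvalue_root_char /eigenvalue /eigenspace kermx_eq0 row_free_unit.
apply: contra zPB => zM; have -> : z *: P + B = - P *m (- (invmx P *m B) - z%:M).
  rewrite mulmxBr mulmxN mulNmx opprK mulmxA mulmxV // mul1mx mulNmx opprK.
  by rewrite mul_mx_scalar addrC.
rewrite unitmx_mul zM andbT.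
by rewrite -scaleN1r unitmxZ // rpredN unitr1.
Qed.

(** * Orbits of the cyclic shift and a criterion for violation *)

Section CyclicOrbits.
Variables (C : numClosedFieldType) (n : nat).
Implicit Types a b : 'cV[C]_n.+1.

Lemma cyclicXE r a i : (cyclicX C n.+1 ^+ r *m a) i 0 = a (inZp (i + r)) 0.
Proof.
elim: r i => [|r IHr] i; first by rewrite expr0 mul1mx addn0 valZpK.
rewrite exprS -mulmxE -mulmxA mxE (bigD1 (ordS i)) //= big1 ?addr0 => [|j nj].
  rewrite mxE eqxx mul1r IHr; congr (a _ 0); apply: val_inj => /=.
  by rewrite modnDml addSnnS.
by rewrite mxE (negPf nj) mul0r.
Qed.

(** Addition in ['I_n.+1] is modulo n + 1, so it absorbs the wrap-around of the shift. *)
Lemma cyclicX_ordE (r : 'I_n.+1) a i : (cyclicX C n.+1 ^+ r *m a) i 0 = a (i + r) 0.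
Proof. by rewrite cyclicXE; congr (a _ 0); apply: val_inj. Qed.

(** This is the permutation matrix of the reflection i -> k - i, an involution, hence its own
    inverse. *)
Lemma circulant_delta_unitmx (k : 'I_n.+1) :
  \matrix_(i < n.+1, r < n.+1) (delta_mx k 0 : 'cV[C]_n.+1) (i + r) 0 \in unitmx.
Proof.
set P := (X in X \in _); suff PP1 : P *m P = 1%:M by have [] := mulmx1_unit PP1.
apply/matrixP => i l; rewrite !mxE (bigD1 (k - i)) //= big1 ?addr0 => [|j nj].
  rewrite !mxE !eqxx !andbT addrC subrK eqxx mul1r; congr (_%:R).
  rewrite [k - i]addrC addrAC -[X in _ == X]add0r (inj_eq (addIr k)) addrC.
  by rewrite subr_eq0 eq_sym.
by rewrite !mxE eqxx andbT [i + j]addrC eq_sym -subr_eq eq_sym (negPf nj) mul0r.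
Qed.

Lemma sum_circulant (F : 'I_n.+1 -> C) i : \sum_(r < n.+1) F (i + r) = \sum_r F r.
Proof. by rewrite [RHS](reindex_inj (addrI i)). Qed.

(** The conclusion of the theorem for an arbitrary family of starting vectors, the finite
    exceptional set being a list. *)
Definition generic_bell_violation (a : C -> 'cV[C]_n.+1) : Prop :=
  exists S : seq C, forall z : C, `|z| = 1 -> z \notin S ->
    let h (r : 'I_n.+1) := <[cyclicX C n.+1 ^+ r *m a z]>%VS in
    [/\ (\sum_(r < n.+1) h r)%VS = fullv,
        (\bigcap_(r < n.+1) orthocompl (h r))%VS = 0%VS
      & exists rho : 'M[C]_n.+1,
          [/\ density_matrix rho,
              \sum_(r < n.+1) qprob (orthocompl (h r)) rho > n.+1%:R - 1
            & \sum_(r < n.+1) qprob (h r) rho < 1]].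

(** Cyclicity makes the squared norm of each orbit vector and each diagonal entry of T the same sum,
    so one normalisation serves both. The [overlap] sum is T_{0,j} up to the factor [c * c^*]. *)
Lemma cyclic_orbit_violation (a : C -> 'cV[C]_n.+1) c k b (j : 'I_n.+1)
    (S0 : seq C) (u := fun z => z *: delta_mx k 0 + b : 'cV[C]_n.+1) :
  (forall z, a z = c *: u z) ->
  (forall z, `|z| = 1 -> c * c^* * \sum_i u z i 0 * (u z i 0)^* = 1) ->
  j != 0 ->
  (forall z, z \notin S0 -> \sum_i u z i 0 * (u z (j + i) 0)^* != 0) ->
  generic_bell_violation a.
Proof.
move=> def_a u1 j0 overlap.
have a2 z i l : a z i 0 * (a z l 0)^* = c * c^* * (u z i 0 * (u z l 0)^*).
  have a_u m : a z m 0 = c * u z m 0 by rewrite def_a mxE.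
  by rewrite !a_u rmorphM /= mulrACA.
have a1 z : `|z| = 1 -> \sum_i a z i 0 * (a z i 0)^* = 1.
  by move=> /u1; rewrite mulr_sumr => <-; apply: eq_bigr => i _; rewrite a2.
have c0 : c != 0.
  apply: contraTneq (oner_neq0 C) => c0.
  by rewrite -(u1 1) ?normr1 // c0 !mul0r eqxx.
have [S unitS] := affine_pencil_unitmx (\matrix_(i, r) b (i + r) 0)
   (circulant_delta_unitmx k).
(* [S0] collects the z that may spoil the overlap, [S] those that may spoil the spanning. *)
exists (S0 ++ S) => z z1; rewrite mem_cat negb_or => /andP[zS0 zS] h.
have h_full : (\sum_(r < n.+1) h r)%VS = fullv.
  pose A := \matrix_(i, r) (cyclicX C n.+1 ^+ (r : 'I_n.+1) *m a z) i 0.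
  apply: (@sum_lines_full _ _ _ _ (invmx A)); apply: (@mulmxV _ _ A).
  have -> : A = c *: (z *: \matrix_(i < n.+1, r < n.+1)
      (delta_mx k 0 : 'cV[C]_n.+1) (i + r) 0 + \matrix_(i, r) b (i + r) 0).
    by apply/matrixP => i r; rewrite mxE cyclicX_ordE def_a /u !mxE.
  by rewrite unitmxZ ?unitfE // unitS.
split=> //; first exact: bigcap_orthocompl.
apply: (@pair_violation _ _ _ _ 0 j); first by rewrite eq_sym.
- under eq_bigr do rewrite !cyclicX_ordE add0r a2.
  by rewrite -mulr_sumr mulf_neq0 ?mul_conjC_eq0 ?overlap.
- move=> r; rewrite cinner_sum; under eq_bigr do rewrite cyclicX_ordE addrC.
  by rewrite (sum_circulant (fun i => a z i 0 * (a z i 0)^*)) a1.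
move=> i; under eq_bigr do rewrite cyclicX_ordE.
by rewrite (sum_circulant (fun i => a z i 0 * (a z i 0)^*)) a1.
Qed.

End CyclicOrbits.

Lemma invr_sqrtC_nat_mul_conj (C : numClosedFieldType) n :
  (sqrtC (n%:R : C))^-1 * ((sqrtC n%:R)^-1)^* = n%:R^-1.
Proof.
rewrite conj_Creal ?rpredV ?ger0_real ?sqrtC_ge0 ?ler0n //.
by rewrite -invfM -expr2 sqrtCK.
Qed.

(** * The two shapes of starting vector, in dimensions 3 and 4 *)

Section FiducialVectors.
Variable C : numClosedFieldType.
Implicit Types c p q : C.

Lemma normC1_mul_conj p : `|p| = 1 -> p * p^* = 1.
Proof. by rewrite -normCK => ->; rewrite expr1n. Qed.

(** The overlap with the shift by one is p z^*, which vanishes only at z = 0; hence the exceptional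
    list [[:: 0]]. *)
Lemma fiducial3_violation (a : C -> 'cV[C]_3) c p :
  c * c^* * (1 + p * p^*) = 1 -> p != 0 ->
  (forall z, a z = c *: colseq 3 [:: p; z; 0]) -> generic_bell_violation a.
Proof.
move=> cp1 p0 def_a.
apply: (@cyclic_orbit_violation _ _ a c 1 (colseq 3 [:: p; 0; 0]) 1 [:: 0]) => //.
- move=> z; rewrite def_a; congr (_ *: _); apply/colP => i.
  by rewrite !mxE -val_eqE; case: i => [[|[|[|]]]] //= ?; ring.
- move=> z /normC1_mul_conj zz1; rewrite !big_ord_recl big_ord0 !mxE -!val_eqE /=.
  rewrite !mulr0 mulr1 !add0r !addr0 mul0r addr0 zz1 -[RHS]cp1.
  by ring.
- move=> z; rewrite inE => z0; rewrite !big_ord_recl big_ord0 !mxE -!val_eqE /=.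
  rewrite !mulr0 mulr1 !add0r !addr0 conjC0 mulr0 mul0r !addr0.
  by rewrite mulf_neq0 ?conjC_eq0.
Qed.

(* Consecutive vectors of the orbit have inner product proportional to
   z p^* + p q^*. *)
Lemma fiducial4_violation (a : C -> 'cV[C]_4) c p q :
  c * c^* * (1 + p * p^* + q * q^*) = 1 -> p != 0 ->
  (forall z, a z = c *: colseq 4 [:: z; p; q; 0]) -> generic_bell_violation a.
Proof.
move=> cpq1 p0 def_a; have cp0 : p^* != 0 by rewrite conjC_eq0.
(* The listed value is the unique root of z p^* + p q^*. *)
apply: (@cyclic_orbit_violation _ _ a c 0 (colseq 4 [:: 0; p; q; 0]) 1
          [:: - (p * q^*) / p^*]) => //.
- move=> z; rewrite def_a; congr (_ *: _); apply/colP => i.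
  by rewrite !mxE -val_eqE; case: i => [[|[|[|[|]]]]] //= ?; ring.
- move=> z /normC1_mul_conj zz1; rewrite !big_ord_recl big_ord0 !mxE -!val_eqE /=.
  rewrite !mulr0 mulr1 !add0r !addr0 mul0r addr0 zz1 -[RHS]cpq1.
  by ring.
- move=> z; rewrite inE => zpq; rewrite !big_ord_recl big_ord0 !mxE -!val_eqE /=.
  rewrite !mulr0 mulr1 !add0r !addr0 conjC0 mulr0 mul0r !addr0.
  apply: contraNneq zpq => /(canRL (addrK _)); rewrite sub0r => <-.
  by rewrite mulfK.
Qed.

End FiducialVectors.

(** * The seven orbits of the three families *)

Lemma omega_mul_conj (R : realType) : omega R * (omega R)^* = 1.
Proof.
apply/eqP; rewrite eq_complex /=; apply/andP; split; apply/eqP; last by ring.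
by rewrite mulrN opprK -!expr2 cos2Dsin2.
Qed.

Theorem mainTheorem4 (R : realType) (d n : nat)
  (hdn : (d, n) \in [:: (3, 6); (4, 8); (4, 12)]%N)
  (mu : 'I_(n %/ d)) :
  exists S : seq R[i], forall z : R[i], `|z| = 1 -> z \notin S ->
    let h (r : 'I_d) := coherent_space d n z mu r in
    [/\ (\sum_(r < d) h r)%VS = fullv,
        (\bigcap_(r < d) orthocompl (h r))%VS = 0%VS
      & exists rho : 'M[R[i]]_d,
          [/\ density_matrix rho,
              \sum_(r < d) qprob (orthocompl (h r)) rho > d%:R - 1
            & \sum_(r < d) qprob (h r) rho < 1]].
Proof.
have ww : omega R * (omega R)^* = 1 := omega_mul_conj R.
have w0 : omega R != 0 by rewrite -mul_conjC_eq0 ww oner_eq0.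
have ww2 : omega R ^+ 2 * (omega R ^+ 2)^* = 1.
  by rewrite rmorphXn -exprMn ww expr1n.
have c2 := invr_sqrtC_nat_mul_conj R[i] 2; have c3 := invr_sqrtC_nat_mul_conj R[i] 3.
case: mu => m /=; move: hdn; rewrite !inE => /or3P[] /eqP[-> ->] {d n}.
- case: m => [|[|m]] // _.
  + apply: (@fiducial3_violation _ (coherent_start 3 6 0) (sqrtC 2)^-1 1) => //; last exact: oner_neq0.
    by rewrite c2 conjC1; field.
  (* The sign moves into the scalar, (1, -z, 0) = -(-1, z, 0), so that z has coefficient 1. *)
  + apply: (@fiducial3_violation _ (coherent_start 3 6 1) (- (sqrtC 2)^-1) (- 1)) => //.
    * by rewrite !rmorphN /= mulrNN c2 conjC1; field.
    * by rewrite oppr_eq0 oner_eq0.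
    * move=> z; rewrite scaleNr -scalerN; congr (_ *: _); apply/colP => i.
      by rewrite !mxE; case: i => [[|[|[|]]]] //= ?; rewrite ?opprK ?oppr0.
- case: m => [|[|m]] // _.
  (* The family (4, 8) is the case q = 0 of the shape (z, p, q, 0). *)
  + apply: (@fiducial4_violation _ (coherent_start 4 8 0) (sqrtC 2)^-1 1 0) => //; last exact: oner_neq0.
    by rewrite c2 conjC1; field.
  + apply: (@fiducial4_violation _ (coherent_start 4 8 1) (sqrtC 2)^-1 (- 1) 0) => //.
      by rewrite c2 rmorphN /= conjC1; field.
    by rewrite oppr_eq0 oner_eq0.
- case: m => [|[|[|m]]] // _.
  + apply: (@fiducial4_violation _ (coherent_start 4 12 0) (sqrtC 3)^-1 1 1) => //; last exact: oner_neq0.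
    by rewrite c3 conjC1; field.
  + apply: (@fiducial4_violation _ (coherent_start 4 12 1) (sqrtC 3)^-1 (omega R) (omega R ^+ 2)) => //.
    by rewrite c3 ww ww2; field.
  + apply: (@fiducial4_violation _ (coherent_start 4 12 2) (sqrtC 3)^-1 (omega R ^+ 2) (omega R)) => //.
      by rewrite c3 ww ww2; field.
    by rewrite expf_neq0.
Qed.
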